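(* Let $n\ge1$, $\alpha\in(0,1)$, $\mu\in(0,1]$, $T>0$, $\tau>0$, let $A,B$ be constant real $n\times n$ matrices, let $\phi:[-\tau,0]\to\mathbb{R}^n$ be continuous, and let $f:[0,T]\times\mathbb{R}^n\times\mathbb{R}^n\to\mathbb{R}^n$ be continuous with $f(t,0,0)=0$. Consider $$ \begin{cases} {}^C\!D_{0}^{\alpha,\mu}y(t)=\exp\!\left(\frac{\mu-1}{\mu}t\right)\left[Ay(t)+By(t-\tau)+f(t,y(t),y(t-\tau))\right], & t\in[0,T],\\ y(t)=\phi(t), & t\in[-\tau,0]. \end{cases} $$ Assume there is $L_f>0$ such that for all functions $y,z:[-\tau,T]\to\mathbb{R}^n$ and all $t\in[0,T]$, $\|f(t,y(t),y(t-\tau))-f(t,z(t),z(t-\tau))\|\le L_f\big(\|y(t)-z(t)\|+\|y(t-\tau)-z(t-\tau)\|\big)$. Set $k=1+\alpha$, $r=1+\frac{1}{\alpha}$, $\omega=\left(\frac{\Gamma(\alpha^2)}{k^{\alpha^2}}\right)^{1/k}$, $$ \psi=\frac{3^{1/\alpha}\big((\|A\|+L_f)^r+(\|B\|+L_f)^r e^{-r\tau}\big)\omega^r}{\mu^{k}\Gamma^r(\alpha)},\qquad \varphi=\frac{3^{1/\alpha}(\|B\|+L_f)^r\big(1-e^{-r\tau}\big)}{r\,\mu^{k}\Gamma^r(\alpha)}\,\omega^r . $$ Let $c_1,c_2$ be positive numbers with $c_1\le c_2$. If $$ \left(\frac{3^{1/\alpha}r+\big(3^{1/\alpha}\psi+r\varphi+\psi\varphi\big)e^{(\psi+r)t}}{r+\psi}\right)^{1/r}\le\frac{c_2}{c_1}\quad\text{for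 all } t\in[0,T], $$ then the system is finite time stable with respect to $\{c_1,c_2,T\}$, i.e. $\|\phi\|_C\le c_1$ implies $\|y(t)\|<c_2$ for all $t\in[0,T]$, where $y$ is the (unique mild) solution.
   Context: $\|\cdot\|$ denotes the Euclidean norm of a vector and the spectral norm of a matrix; $\|\phi\|_C=\sup_{t\in[-\tau,0]}\|\phi(t)\|$. $\Gamma$ is Euler's Gamma function. For $\alpha>0$, $\mu\in(0,1]$, the generalized proportional fractional integral is ${}^C\!I_{0}^{\alpha,\mu}h(t)=\frac{1}{\mu^{\alpha}\Gamma(\alpha)}\int_0^t \exp\!\left(\frac{\mu-1}{\mu}(t-s)\right)(t-s)^{\alpha-1}h(s)\,ds$, and for $\alpha\in(0,1)$ the Caputo generalized proportional fractional derivative is ${}^C\!D_{0}^{\alpha,\mu}h(t)=\frac{1}{\mu^{1-\alpha}\Gamma(1-\alpha)}\int_0^t \exp\!\left(\frac{\mu-1}{\mu}(t-s)\right)(t-s)^{-\alpha}\big((1-\mu)h(s)+\mu h'(s)\big)\,ds$ (applied componentwise to vector functions). A (mild) solution is a function $y:[-\tau,T]\to\mathbb{R}^n$ with $y=\phi$ on $[-\tau,0]$ and, for $t\in[0,T]$, $y(t)=\phi(0)\exp\!\left(\frac{\mu-1}{\mu}t\right)+{}^C\!I_{0}^{\alpha,\mu}\Big[\exp\!\left(\frac{\mu-1}{\mu}s\right)\big(Ay(s)+By(s-\tau)+f(s,y(s),y(s-\tau))\big)\Big](t)$; under the Lipschitz condition such a solution exists and is unique. *)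

(* Defs.v *)
From HB Require Import structures.
From mathcomp Require Import all_boot all_order all_algebra.
From mathcomp Require Import all_classical all_reals all_analysis.
Set Implicit Arguments. Unset Strict Implicit. Unset Printing Implicit Defensive.
Import Order.TTheory GRing.Theory Num.Theory.
Import numFieldNormedType.Exports.
Local Open Scope classical_set_scope.
Local Open Scope ring_scope.

Section Defs.
Variable R : realType.

Definition Gamma (a : R) : R :=
  Rintegral (@lebesgue_measure R) `]0, +oo[%classic
    (fun x => x `^ (a - 1) * expR (- x)).

Definition vnorm (n : nat) (x : 'cV[R]_n) : R :=
  Num.sqrt (\sum_(i < n) (x i ord0) ^+ 2).

Definition mnorm (n : nat) (A : 'M[R]_n) : R :=
  sup [set vnorm (A *m x) | x in [set x : 'cV[R]_n | vnorm x <= 1]].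

Definition Cnorm (n : nat) (tau : R) (phi : R -> 'cV[R]_n) : R :=
  sup [set vnorm (phi t) | t in `[- tau, 0]%classic].

Definition GPFI (n : nat) (alpha mu : R) (h : R -> 'cV[R]_n) (t : R)
  : 'cV[R]_n :=
  \col_(i < n)
    ((mu `^ alpha * Gamma alpha)^-1 *
      Rintegral (@lebesgue_measure R) `[0, t]%classic
        (fun s => expR ((mu - 1) / mu * (t - s)) * (t - s) `^ (alpha - 1)
                  * h s i ord0)).

Definition mild_solution (n : nat) (alpha mu T tau : R) (A B : 'M[R]_n)
  (f : R -> 'cV[R]_n -> 'cV[R]_n -> 'cV[R]_n) (phi : R -> 'cV[R]_n)
  (y : R -> 'cV[R]_n) : Prop :=
  {within `[- tau, T]%classic, continuous y} /\
  (forall t, - tau <= t <= 0 -> y t = phi t) /\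
  (forall t, 0 <= t <= T ->
     y t = expR ((mu - 1) / mu * t) *: phi 0
           + GPFI alpha mu
               (fun s => expR ((mu - 1) / mu * s) *:
                  (A *m y s + B *m y (s - tau) + f s (y s) (y (s - tau)))) t).

End Defs.

(* Main.v *)
Require Import Defs.
From HB Require Import structures.
From mathcomp Require Import all_boot all_order all_algebra.
From mathcomp Require Import all_classical all_reals all_analysis.
From mathcomp Require Import measurable_realfun ring lra.
Import Order.TTheory GRing.Theory Num.Theory.
Import numFieldNormedType.Exports.
Local Open Scope classical_set_scope.
Local Open Scope ring_scope.

(* The mild-solution equation, the Lipschitz bound and f(t,0,0) = 0 give
     |y t| <= c1 + K int_0^t (t-s)^(alpha-1) (a |y s| + b |y (s-tau)|) ds.
   Writing the integrand as ((t-s)^(alpha-1) e^s) (e^(-s) ...), Hoelder with the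
   conjugate exponents k = 1+alpha and r = 1+1/alpha bounds the weakly singular
   factor by omega e^t.  Raising to the power r with (x+y+z)^r <= 3^(r-1) (...)
   yields, for v t := e^(-rt) |y t|^r, a linear Gronwall inequality
     v t <= 3^(1/alpha) c1^r e^(-rt) + c1^r varphi + psi int_0^t v
   whose explicit solution is the hypothesised expression times c1^r e^(-rt).
   The final inequality is strict because v 0 <= c1^r is strictly below the value
   of that solution at 0. *)

(** The kernel exponent alpha - 1 is negative, so Hoelder with exponent 2 would fail for alpha <=
    1/2. The k-th power of the kernel is integrable near s = t exactly when k < 1/(1 - alpha), and k
    = 1 + alpha meets this for every alpha in (0,1). Since k (alpha - 1) = alpha^2 - 1, the number
    Gamma(alpha^2) enters omega. The other constants come from the conjugate exponent r: r - 1 =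
    1/alpha gives the factor 3^(1/alpha), and alpha r = k turns the r-th power of K = 1/(mu^alpha
    Gamma(alpha)) into 1/(mu^k Gamma(alpha)^r). Moving the delay out of the integral costs e^(-r
    tau), which joins psi; what the shifted integral collects on [-tau, 0], where |y| <= c1, becomes
    varphi. The factors exp((mu - 1)/mu ...) are at most 1 because mu <= 1, and they are dropped as
    soon as norms are taken. *)

(** * Affine change of variables for Lebesgue integrals *)

Section affine.
Context {R : realType}.
Notation leb := (@lebesgue_measure R).
Local Open Scope ereal_scope.

Definition affine (c b : R) (x : measurableTypeR R) : measurableTypeR R := (c * x + b)%R.

Lemma measurable_affine c b : measurable_fun [set: measurableTypeR R] (affine c b).
Proof. by apply: measurable_funD => //; exact: mulrl_measurable. Qed.

Lemma lebesgue_measure_affine_ocitv (c b : R) (X : set R) : c != 0%R -> ocitv X ->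
  leb X = `|c|%:E * leb (affine c b @^-1` X).
Proof.
move=> c0 [[u v] _ <-] /=.
have [c_lt0|c_gt0|c00] := ltgtP c 0%R; last by rewrite c00 eqxx in c0.
- have -> : affine c b @^-1` `]u, v]%classic =
            `[((v - b) / c)%R, ((u - b) / c)%R[%classic.
    apply/seteqP; split => x /=; rewrite /affine !in_itv/= => /andP[h1 h2].
      by rewrite ler_ndivrMr// ltr_ndivlMr// mulrC lerBrDr ltrBlDr h1 h2.
    move: h1 h2; rewrite ler_ndivrMr// ltr_ndivlMr// mulrC lerBrDr ltrBlDr.
    by move=> -> ->.
  rewrite !lebesgue_measure_itv/= !lte_fin ltr_ndivrMr// divfK// ltrD2r.
  case: ifPn => _; last by rewrite mule0.
  rewrite -EFinD -EFinM ltr0_norm//; congr EFin; by field.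
- have -> : affine c b @^-1` `]u, v]%classic =
            `]((u - b) / c)%R, ((v - b) / c)%R]%classic.
    apply/seteqP; split => x /=; rewrite /affine !in_itv/= => /andP[h1 h2].
      by rewrite ltr_pdivrMr// ler_pdivlMr// mulrC lerBrDr ltrBlDr h1 h2.
    move: h1 h2; rewrite ltr_pdivrMr// ler_pdivlMr// mulrC lerBrDr ltrBlDr.
    by move=> -> ->.
  rewrite !lebesgue_measure_itv/= !lte_fin ltr_pdivrMr// divfK// ltrD2r.
  case: ifPn => _; last by rewrite mule0.
  rewrite -EFinD -EFinM gtr0_norm//; congr EFin; by field.
Qed.

(** Lebesgue measure equals |c| times its pushforward under the affine map: the two agree on
    half-open intervals, hence everywhere by uniqueness. Working with nonnegative functions allows
    singular kernels before their integrability is known. *)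
Lemma ge0_integral_affine (c b : R) (D : set R) (f : R -> \bar R) :
  c != 0%R -> measurable D -> measurable_fun D f -> (forall x, D x -> 0 <= f x) ->
  \int[leb]_(y in D) f y =
  `|c|%:E * \int[leb]_(x in affine c b @^-1` D) f (c * x + b)%R.
Proof.
move=> c0 mD mf f0.
pose k : {nonneg R} := NngNum (normr_ge0 c : 0 <= `|c|)%R.
have nuE A : measurable A -> leb A = mscale k (pushforward leb (affine c b)) A.
  apply: lebesgue_measure_unique => X; exact: lebesgue_measure_affine_ocitv.
rewrite -(ge0_integral_pushforward (measurable_affine c b) leb mD
  (mf : measurable_fun (D : set (measurableTypeR R)) _)); last first.
  by move=> x; rewrite inE; exact: f0.
rewrite -[`|c|%R]/(k%:num) -ge0_integral_mscale//; first exact: measurable_affine.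
by move=> maff; apply: eq_measure_integral => A mA _; exact: nuE.
Qed.

End affine.

(** * The Gamma integral on (0, 1] and the exponentially weighted singular kernel *)

Section gamma.
Context {R : realType}.
Notation leb := (@lebesgue_measure R).
Local Open Scope ereal_scope.
Implicit Types a k t : R.

Lemma measurable_powR_subr (t a : R) (D : set R) :
  measurable_fun D (fun s => (t - s) `^ a)%R.
Proof.
apply/measurable_funTS/(measurableT_comp (measurable_powR a)).
exact: measurable_funB.
Qed.

Lemma measurable_expRM (c : R) (D : set R) :
  measurable_fun D (fun s => expR (c * s))%R.
Proof.
apply/measurable_funTS/(measurableT_comp (@measurable_expR R)).
exact: mulrl_measurable.
Qed.

Lemma measurable_Gamma_integrand a (D : set R) :
  measurable_fun D (fun x => x `^ (a - 1) * expR (- x))%R.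
Proof.
apply: measurable_funTS; apply: measurable_funM; first exact: measurable_powR.
exact: measurableT_comp.
Qed.

(** The integrand may blow up at 0, so the fundamental theorem is applied on [1/(n+1), 1], where the
    antiderivative x^a / a gives at most 1/a; monotone convergence over n concludes. *)
Lemma integral_powR_01 a : (0 < a)%R ->
  \int[leb]_(x in `]0%R, 1%R]) (x `^ (a - 1))%:E <= (a^-1)%:E.
Proof.
move=> a0.
pose F n : set R := `[(n.+1%:R^-1)%R, 1%R]%classic.
have FE : `]0%R, 1%R]%classic = \bigcup_n F n.
  apply/seteqP; split => [x/= | x [n _]] /=; rewrite /F/= !in_itv/= => /andP[x0 x1].
    exists (Num.truncn x^-1) => //=; rewrite in_itv/= x1 andbT.
    rewrite invf_ple ?posrE//.
    by apply/ltW; exact: truncnS_gt.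
  by rewrite x1 andbT (lt_le_trans _ x0)// invr_gt0.
rewrite FE.
have mF n : measurable (F n) by exact: measurable_itv.
have cv : \int[leb]_(x in F i) (x `^ (a - 1))%:E @[i --> \oo] -->
    \int[leb]_(x in \bigcup_i F i) (x `^ (a - 1))%:E.
  apply: ge0_nondecreasing_set_cvg_integral => //.
  - move=> m n mn; rewrite subsetEset; apply: subset_itvr.
    by rewrite bnd_simp lef_pV2 ?posrE// ler_nat.
  - by move=> i; apply/measurable_EFinP/measurable_funTS; exact: measurable_powR.
  - by move=> i x _; rewrite lee_fin powR_ge0.
rewrite -(cvg_lim _ cv)//; apply: lime_le; first by apply/cvg_ex; eexists; exact: cv.
apply: nearW => n.
have n0 : (0 < n.+1%:R^-1 :> R)%R by rewrite invr_gt0.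
(* For n = 0 the interval degenerates to the point 1 and is treated apart from the fundamental
   theorem. *)
have [n1|n1] := ltP (n.+1%:R^-1)%R (1:R)%R; last first.
  apply: (@le_trans _ _ 0); last by rewrite lee_fin invr_ge0 ltW.
  rewrite le_eqVlt; apply/orP; left; apply/eqP.
  have := n1; rewrite le_eqVlt => /predU1P[n1'|n1'].
    by rewrite /F -n1' set_itv1 integral_set1.
  by rewrite /F set_itv_ge ?bnd_simp -?ltNge// integral_set0.
have dF (x : R) : (0 < x)%R ->
    is_derive x (1:R)%R (fun x => x `^ a / a)%R (x `^ (a - 1))%R.
  move=> x0; have h := is_derive1_powR a x0.
  rewrite (_ : (fun x => _) = a^-1 *: (fun y : R => y `^ a))%R; last first.
    by apply/funext => y /=; rewrite mulrC.
  by apply: is_derive_eq; rewrite /GRing.scale/= mulKf// gt_eqF.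
have cF (x : R) : (0 < x)%R -> {for x, continuous (fun x => x `^ a / a)%R}.
  move=> x0; apply/differentiable_continuous/derivable1_diffP.
  exact: (@ex_derive _ _ _ _ _ _ _ (dF x x0)).
rewrite (@continuous_FTC2 _ _ (fun x => x `^ a / a)%R)//.
- rewrite -EFinB lee_fin powR1 mul1r gerBl divr_ge0 ?powR_ge0//.
  exact: ltW.
- apply: continuous_in_subspaceT => x; rewrite inE/= in_itv/= => /andP[nx _].
  apply/differentiable_continuous/derivable1_diffP; apply: derivable_powR.
  by rewrite in_itv/= andbT (lt_le_trans n0).
- split.
  + move=> x; rewrite in_itv/= => /andP[nx _].
    by apply: (@ex_derive _ _ _ _ _ _ _ (dF x _)); exact: lt_trans nx.
  + by apply/cvg_at_right_filter; exact: cF.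
  + by apply/cvg_at_left_filter; exact: cF.
- move=> x; rewrite in_itv/= => /andP[nx _].
  rewrite derive1E; apply: (@derive_val _ _ _ _ _ _ _ (dF x _)).
  exact: lt_trans nx.
Qed.

(** On (0, 1] the exponential is at most 1 and the power is integrable; beyond 1 the power is at
    most 1 because a <= 1, and the rest is dominated by the exponential density of rate 1. *)
Lemma Gamma_integral_lty a : (0 < a <= 1)%R ->
  \int[leb]_(x in `]0%R, +oo[) (x `^ (a - 1) * expR (- x))%:E < +oo.
Proof.
move=> /andP[a0 a1].
have -> : `]0%R, +oo[%classic = `]0%R, 1%R] `|` `]1%R, +oo[%classic :> set R.
  by rewrite -itv_bndbnd_setU// bnd_simp.
rewrite ge0_integral_setU//=; last 3 first.
- by apply/measurable_EFinP; exact: measurable_Gamma_integrand.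
- by move=> x _; rewrite lee_fin mulr_ge0 ?powR_ge0 ?expR_ge0.
- apply/disj_setPS => x [/=]; rewrite !in_itv/= andbT.
  by move=> /andP[_ /le_lt_trans] /[apply]; rewrite ltxx.
apply: lte_add_pinfty.
  apply: (@le_lt_trans _ _ (a^-1)%:E); last exact: ltry.
  apply: (@le_trans _ _ (\int[leb]_(x in `]0%R, 1%R]) (x `^ (a - 1))%:E));
    last exact: integral_powR_01.
  apply: ge0_le_integral => //.
  - by move=> x _; rewrite lee_fin mulr_ge0 ?powR_ge0 ?expR_ge0.
  - by apply/measurable_EFinP; exact: measurable_Gamma_integrand.
  - by apply/measurable_EFinP/measurable_funTS; exact: measurable_powR.
  - move=> x /=; rewrite in_itv/= => /andP[x0 _]; rewrite lee_fin.
    by rewrite ler_piMr ?powR_ge0// expR_le1 oppr_le0 ltW.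
have := @integral_exponential_pdf R 1 ltr01.
move=> e1; apply: (@le_lt_trans _ _ 1); last exact: ltry.
rewrite -e1.
have mpdf (D : set R) : measurable_fun D (EFin \o exponential_pdf (1:R)).
  apply: measurable_funTS; apply/measurable_EFinP.
  exact: measurable_exponential_pdf.
have pdf0 (x : R) : (0 <= exponential_pdf 1 x)%R by apply: exponential_pdf_ge0.
apply: (@le_trans _ _ (\int[leb]_(x in `]1%R, +oo[) (exponential_pdf 1 x)%:E)).
  apply: ge0_le_integral => //=.
  - by move=> x _; rewrite lee_fin mulr_ge0 ?powR_ge0 ?expR_ge0.
  - by apply/measurable_EFinP; exact: measurable_Gamma_integrand.
  - exact: mpdf.
  - move=> x; rewrite in_itv/= andbT => x1; rewrite lee_fin.
    have x0 : (0 < x)%R := lt_trans ltr01 x1.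
    rewrite exponential_pdfE  ?(ltW x0)// mul1r mulN1r ler_piMl ?expR_ge0//.
    by rewrite -[leRHS](powRr0 x); apply: ler_powR; [exact: ltW | rewrite subr_le0].
apply: ge0_subset_integral => //=; first exact: mpdf.
by move=> x _; rewrite lee_fin.
Qed.

(** [Rintegral] reads an infinite integral as 0; finiteness is what makes [Gamma] the true value. *)
Lemma GammaE a : (0 < a <= 1)%R ->
  \int[leb]_(x in `]0%R, +oo[) (x `^ (a - 1) * expR (- x))%:E = (Gamma a)%:E.
Proof.
move=> a01; rewrite /Gamma /Rintegral fineK// ge0_fin_numE.
  exact: Gamma_integral_lty.
by apply: integral_ge0 => x _; rewrite lee_fin mulr_ge0 ?powR_ge0 ?expR_ge0.
Qed.

Lemma Gamma_gt0 a : (0 < a <= 1)%R -> (0 < Gamma a)%R.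
Proof.
move=> /[dup] a01 /andP[a0 a1]; rewrite -lte_fin -GammaE//.
apply: (@lt_le_trans _ _ (\int[leb]_(x in `]0%R, 1%R]) (expR (- 1))%:E)).
  rewrite integral_cst//= lebesgue_measure_itv/= lte_fin ltr01 oppr0 adde0 mule1.
  by rewrite lte_fin expR_gt0.
apply: (@le_trans _ _
    (\int[leb]_(x in `]0%R, 1%R]) (x `^ (a - 1) * expR (- x))%:E)).
  apply: ge0_le_integral => //=.
  - by apply/measurable_EFinP; exact: measurable_Gamma_integrand.
  - move=> x; rewrite in_itv/= => /andP[x0 x1]; rewrite lee_fin.
    rewrite -[leLHS]mul1r ler_pM ?expR_ge0 ?ler_expR ?lerN2//.
    by rewrite -{1}(powRr0 x); apply: ger_powR; [rewrite x0 | rewrite subr_le0].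
apply: ge0_subset_integral => //=.
- by apply/measurable_EFinP; exact: measurable_Gamma_integrand.
- by move=> x _; rewrite lee_fin mulr_ge0 ?powR_ge0 ?expR_ge0.
- by apply: subset_itvl.
Qed.

(** The substitution x = k (t - s) gives e^(k t) k^(-a) times an incomplete Gamma integral;
    enlarging the range of s from [0, t) to (-oo, t) completes it. *)
Lemma kernel_integral_le a k t : (0 < a <= 1)%R -> (0 < k)%R ->
  \int[leb]_(s in `[0%R, t]) ((t - s) `^ (a - 1) * expR (k * s))%:E <=
  (expR (k * t) * Gamma a / k `^ a)%:E.
Proof.
move=> a01 k0.
have mK (D : set R) : measurable_fun D
    (EFin \o (fun s : R => (t - s) `^ (a - 1) * expR (k * s))%R).
  apply/measurable_EFinP; apply: measurable_funM.
    exact: measurable_powR_subr.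
  exact: measurable_expRM.
have K0 s : (0 <= (t - s) `^ (a - 1) * expR (k * s))%R.
  by rewrite mulr_ge0 ?powR_ge0 ?expR_ge0.
(* Under the substitution []0, +oo[] corresponds to []-oo, t[], so the null endpoint s = t is
   removed to obtain a subset of it. *)
rewrite -integral_itv_bndo_bndc//.
pose g (x : R) := ((- k * x + k * t) `^ (a - 1) * expR (- (- k * x + k * t)))%R.
have g0 x : (0 <= g x)%R by rewrite mulr_ge0 ?powR_ge0 ?expR_ge0.
have mg (D : set R) : measurable_fun D (EFin \o g).
  apply/measurable_EFinP; apply: measurable_funTS.
  apply: (measurableT_comp (@measurable_Gamma_integrand a setT)).
  exact: measurable_affine.
have GE : (Gamma a)%:E = k%:E * \int[leb]_(x in `]-oo, t[) (g x)%:E.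
  rewrite -GammaE// (@ge0_integral_affine _ (- k) (k * t)) ?oppr_eq0 ?gt_eqF//.
  - rewrite normrN gtr0_norm//; congr (_ * _).
    suff -> : affine (- k) (k * t) @^-1` `]0%R, +oo[%classic = `]-oo, t[%classic by [].
    apply/seteqP; split=> x /=;
    by rewrite !in_itv/= andbT /affine mulNr addrC subr_gt0 ltr_pM2l.
  - by apply/measurable_EFinP; exact: measurable_Gamma_integrand.
  - by move=> x _; rewrite lee_fin mulr_ge0 ?powR_ge0 ?expR_ge0.
have C0 : (0 <= expR (k * t) / k `^ a * k)%R.
  by rewrite mulr_ge0 ?divr_ge0 ?expR_ge0 ?powR_ge0// ltW.
rewrite [leLHS](_ : _ =
    \int[leb]_(s in `[0%R, t[) ((expR (k * t) / k `^ a * k)%:E * (g s)%:E)); last first.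
  apply: eq_integral => s; rewrite inE/= in_itv/= => /andP[s0 st].
  have -> : g s = (k `^ (a - 1) * (t - s) `^ (a - 1) * expR (k * s - k * t))%R.
    rewrite /g -powRM ?ltW ?subr_gt0//; congr (_ `^ _ * expR _)%R; ring.
  have -> : (k `^ a = k `^ (a - 1) * k)%R.
    by rewrite mulrC mulr_powRB1 ?ltW//; case/andP: a01.
  rewrite -EFinM expRB; congr EFin; field.
  by rewrite !gt_eqF ?powR_gt0 ?expR_gt0.
rewrite ge0_integralZl_EFin//; [|by move=> x _; rewrite lee_fin|exact: mg].
have -> : (expR (k * t) * Gamma a / k `^ a)%:E =
    (expR (k * t) / k `^ a)%:E * (Gamma a)%:E by rewrite -EFinM mulrAC.
rewrite GE muleA -EFinM; apply: lee_wpmul2l; first by rewrite lee_fin.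
apply: ge0_subset_integral => //.
- exact: mg.
- by move=> x _; rewrite lee_fin.
- exact: subset_itvr.
Qed.

End gamma.

(** * Hoelder's inequality for the weakly singular kernel *)

Lemma continuous_integrable {R : realType} (f : R -> R) (a b : R) :
  continuous f -> (@lebesgue_measure R).-integrable `[a, b] (EFin \o f).
Proof.
move=> cf; apply: continuous_compact_integrable; first exact: segment_compact.
exact: continuous_subspaceT.
Qed.

(** Hoelder on the whole space is applied to the extensions by zero, which is harmless because 0^c =
    0 for c > 0. *)
Lemma ge0_hoelder_set d (T : measurableType d) (R : realType)
    (mu : {measure set T -> \bar R}) (D : set T) (f g : T -> R) (p q : R) :
  measurable D -> measurable_fun D f -> measurable_fun D g ->
  (forall x, D x -> 0 <= f x) -> (forall x, D x -> 0 <= g x) ->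
  0 < p -> 0 < q -> p^-1 + q^-1 = 1 ->
  (\int[mu]_(x in D) (f x * g x)%:E <=
   (\int[mu]_(x in D) (f x `^ p)%:E) `^ p^-1 *
   (\int[mu]_(x in D) (g x `^ q)%:E) `^ q^-1)%E.
Proof.
move=> mD mf mg f0 g0 p0 q0 pq.
have := @hoelder _ T R mu (f \_ D) (g \_ D) p q
  ((measurable_restrictT f mD).1 mf) ((measurable_restrictT g mD).1 mg) p0 q0 pq.
have normE (h : T -> R) (c : R) : 0 < c -> (forall x, D x -> 0 <= h x) ->
    (Lnorm mu c%:E (EFin \o h \_ D) = (\int[mu]_(x in D) (h x `^ c)%:E) `^ c^-1)%E.
  move=> c0 h0; rewrite Lnorm.unlock [in RHS]integral_mkcond.
  rewrite -[LHS]/((\int[mu]_x `|(EFin \o h \_ D) x| `^ c) `^ c^-1)%E.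
  suff /eq_integral -> : {in setT, forall x, (`|(EFin \o h \_ D) x| `^ c)%E =
    ((fun x => (h x `^ c)%:E) \_ D) x} by [].
  move=> x _ /=.
  rewrite !patchE; case: ifPn => xD.
    by rewrite ger0_norm// h0//; exact: set_mem.
  by rewrite normr0 powR0// gt_eqF.
rewrite !normE// Lnorm1; apply: le_trans.
rewrite integral_mkcond le_eqVlt; apply/orP; left; apply/eqP.
apply: eq_integral => x _ /=; rewrite !patchE; case: ifPn => xD.
  by rewrite ger0_norm// mulr_ge0// ?f0// ?g0//; exact: set_mem.
by rewrite mulr0 normr0.
Qed.

(** Continuity at 0 is two-sided, whereas [powR] follows the usual power only for nonnegative bases;
    hence the absolute value. *)
Lemma continuous_normr_powR {R : realType} (r : R) : 0 < r ->
  continuous (fun x : R => `|x| `^ r).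
Proof.
move=> r0 x; have [->|x0] := eqVneq x 0.
  rewrite /continuous_at normr0 powR0 ?gt_eqF//.
  apply/cvgrPdist_lt => e e0; near=> y.
  rewrite sub0r normrN ger0_norm ?powR_ge0//.
  have -> : e = (e `^ r^-1) `^ r by rewrite -powRrM mulVf ?gt_eqF// powRr1// ltW.
  apply: gt0_ltr_powR; rewrite ?nnegrE ?powR_ge0//.
  rewrite -[`|y|](normrN y) -[- y]sub0r.
  by near: y; apply: cvgr_dist_lt; [exact: cvg_id | exact: powR_gt0].
apply: (@continuous_comp R R R (fun x => `|x|) (fun y => y `^ r)).
  exact: (@norm_continuous _ R^o).
apply/differentiable_continuous/derivable1_diffP.
by apply: derivable_powR; rewrite in_itv/= andbT normr_gt0.
Unshelve. all: by end_near. Qed.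

Lemma continuous_powR_ge0 {R : realType} (T : topologicalType) (u : T -> R) (r : R) :
  0 < r -> continuous u -> (forall s, 0 <= u s) -> continuous (fun s => u s `^ r).
Proof.
move=> r0 cu u0.
rewrite (_ : (fun s => _) = (fun x : R => `|x| `^ r) \o u).
  by move=> s; apply: continuous_comp; [exact: cu | exact: continuous_normr_powR].
by apply/funext => s /=; rewrite ger0_norm.
Qed.

Section hoelder_kernel.
Context {R : realType}.
Notation leb := (@lebesgue_measure R).

Lemma continuous_expRM (c : R) : continuous (fun s : R => expR (c * s)).
Proof.
by move=> s; apply: continuous_comp; [exact: mulrl_continuous | exact: continuous_expR].
Qed.

Lemma continuous_expRNM (c : R) : continuous (fun s : R => expR (- (c * s))).
Proof.
rewrite (_ : (fun s => _) = (fun s : R => expR (- c * s))); first exact: continuous_expRM.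
by apply/funext => s; rewrite mulNr.
Qed.

(** The inserted weight e^s makes the kernel factor bounded by a pure multiple of e^t, with no power
    of t; the compensating e^(-s), raised to the power r, is the weight e^(-r s) of the Gronwall
    unknown. *)
Lemma hoelder_kernel (alpha k r t : R) (u : R -> R) :
  0 < alpha < 1 -> continuous u -> (forall s, 0 <= u s) ->
  k = 1 + alpha -> r = 1 + alpha^-1 ->
  \int[leb]_(s in `[0, t]) ((t - s) `^ (alpha - 1) * u s) <=
  (Gamma (alpha ^+ 2) / k `^ (alpha ^+ 2)) `^ (k^-1) * expR t *
  (\int[leb]_(s in `[0, t]) (expR (- (r * s)) * u s `^ r)) `^ (r^-1).
Proof.
move=> /andP[a0 a1] cu u0 kE rE.
have k0 : 0 < k by rewrite kE; lra.
have r0 : 0 < r by rewrite rE addr_gt0 ?invr_gt0.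
have kr : k^-1 + r^-1 = 1 by rewrite kE rE; field; rewrite !gt_eqF//; lra.
have mD : measurable (`[0, t]%classic : set (measurableTypeR R)) by exact: measurable_itv.
have mf : measurable_fun `[0, t]%classic (fun s => (t - s) `^ (alpha - 1) * expR s).
  apply: measurable_funM; first exact: measurable_powR_subr.
  exact: measurable_funTS.
have mg : measurable_fun `[0, t]%classic (fun s : R => expR (- s) * u s).
  apply/measurable_funTS/measurable_funM; last exact: continuous_measurable_fun.
  exact: measurableT_comp.
have cw : continuous (fun s : R => expR (- (r * s)) * u s `^ r).
  by move=> s; apply: cvgM; [exact: continuous_expRNM | exact: continuous_powR_ge0].
have := @ge0_hoelder_set _ _ R leb `[0, t]%classic
  (fun s => (t - s) `^ (alpha - 1) * expR s) (fun s => expR (- s) * u s) k r.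
have f0 s : `[0, t]%classic s -> 0 <= (t - s) `^ (alpha - 1) * expR s.
  by move=> _; rewrite mulr_ge0 ?powR_ge0 ?expR_ge0.
have g0 s : `[0, t]%classic s -> 0 <= expR (- s) * u s.
  by move=> _; rewrite mulr_ge0 ?expR_ge0.
move=> /(_ mD mf mg f0 g0 k0 r0 kr).
have -> : (\int[leb]_(x in `[0%R, t]) ((t - x) `^ (alpha - 1) * expR x * (expR (- x) * u x))%:E
  = \int[leb]_(x in `[0%R, t]) ((t - x) `^ (alpha - 1) * u x)%:E)%E.
  apply: eq_integral => x _; congr EFin.
  by rewrite expRN; field; rewrite gt_eqF ?expR_gt0.
have -> : (\int[leb]_(x in `[0%R, t]) (((t - x) `^ (alpha - 1) * expR x) `^ k)%:E
  = \int[leb]_(x in `[0%R, t]) ((t - x) `^ (alpha ^+ 2 - 1) * expR (k * x))%:E)%E.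
  apply: eq_integral => x _; congr EFin.
  rewrite powRM ?powR_ge0 ?expR_ge0// -powRrM -expRM (mulrC x).
  by congr (_ `^ _ * _); rewrite kE; ring.
have -> : (\int[leb]_(x in `[0%R, t]) ((expR (- x) * u x) `^ r)%:E
  = \int[leb]_(x in `[0%R, t]) (expR (- (r * x)) * u x `^ r)%:E)%E.
  apply: eq_integral => x _; congr EFin.
  by rewrite powRM ?expR_ge0// -expRM mulNr (mulrC x).
have a201 : 0 < alpha ^+ 2 <= 1 by rewrite exprn_gt0//= expr_le1// ltW.
move=> H.
have {}H : (\int[leb]_(x in `[0%R, t]) ((t - x) `^ (alpha - 1) * u x)%:E <=
    ((Gamma (alpha ^+ 2) / k `^ (alpha ^+ 2)) `^ (k^-1) * expR t *
  (\int[leb]_(s in `[0, t]) (expR (- (r * s)) * u s `^ r)) `^ (r^-1))%:E)%E.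
  apply: (le_trans H); rewrite EFinM -[X in (_ <= _ * X)%E]poweR_EFin.
  rewrite fineK; last by apply: integrable_fin_num => //; exact: continuous_integrable.
  apply: lee_wpmul2r; first exact: poweR_ge0.
  have -> : (Gamma (alpha ^+ 2) / k `^ (alpha ^+ 2)) `^ k^-1 * expR t =
    (expR (k * t) * Gamma (alpha ^+ 2) / k `^ (alpha ^+ 2)) `^ k^-1.
    rewrite -mulrA [in RHS]powRM ?expR_ge0//; last first.
      by rewrite divr_ge0 ?powR_ge0// ltW// Gamma_gt0.
    by rewrite -expRM mulrAC divff ?gt_eqF// mul1r mulrC.
  rewrite -poweR_EFin; apply: gt0_ler_poweR; last exact: kernel_integral_le.
  - by rewrite invr_ge0 ltW.
  - rewrite in_itv/= leey andbT; apply: integral_ge0 => x _.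
    by rewrite lee_fin mulr_ge0 ?powR_ge0 ?expR_ge0.
  - rewrite in_itv/= leey andbT lee_fin divr_ge0 ?powR_ge0// mulr_ge0 ?expR_ge0//.
    by rewrite ltW// Gamma_gt0.
(* The bound [H] itself shows that the left integral is finite, so the extended inequality descends
   to real numbers. *)
rewrite -lee_fin /Rintegral fineK//.
rewrite ge0_fin_numE ?(le_lt_trans H) ?ltry//.
apply: integral_ge0 => x _; rewrite lee_fin.
by rewrite mulr_ge0// powR_ge0.
Qed.
End hoelder_kernel.

Lemma continuous_sumr (R : realType) (T : topologicalType) (I : Type) (s : seq I)
    (h : I -> T -> R) :
  (forall i, continuous (h i)) -> continuous (fun x => \sum_(i <- s) h i x).
Proof.
move=> ch; elim: s => [|i s IH] x.
  rewrite /continuous_at big_nil; under eq_fun do rewrite big_nil.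
  exact: cvg_cst.
rewrite /continuous_at big_cons; under eq_fun do rewrite big_cons.
by apply: cvgD; [exact: ch | exact: IH].
Qed.

(** * Euclidean norm, spectral norm and norms of vector integrals *)

Section vnorm.
Context {R : realType} {n : nat}.
Implicit Types (x y z : 'cV[R]_n).

Definition vdot x y := \sum_(i < n) x i ord0 * y i ord0.

Lemma vdotxx_ge0 x : 0 <= vdot x x.
Proof. by apply: sumr_ge0 => i _; rewrite -expr2 sqr_ge0. Qed.

Lemma vnormE x : vnorm x = Num.sqrt (vdot x x).
Proof. by congr Num.sqrt; apply: eq_bigr => i _; rewrite expr2. Qed.

Lemma sqr_vnorm x : vnorm x ^+ 2 = vdot x x.
Proof. by rewrite vnormE sqr_sqrtr// vdotxx_ge0. Qed.

Lemma vnorm_ge0 x : 0 <= vnorm x.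
Proof. exact: sqrtr_ge0. Qed.

Lemma vdotDr z x y : vdot z (x + y) = vdot z x + vdot z y.
Proof. by rewrite -big_split; apply: eq_bigr => i _; rewrite mxE mulrDr. Qed.

Lemma vdotZr z a x : vdot z (a *: x) = a * vdot z x.
Proof. by rewrite mulr_sumr; apply: eq_bigr => i _; rewrite mxE mulrCA. Qed.

Lemma vdotC x y : vdot x y = vdot y x.
Proof. by apply: eq_bigr => i _; rewrite mulrC. Qed.

Lemma vnormZ a x : vnorm (a *: x) = `|a| * vnorm x.
Proof.
by rewrite !vnormE vdotZr vdotC vdotZr mulrA -expr2 sqrtrM ?sqr_ge0// sqrtr_sqr.
Qed.

Lemma vnorm0 : vnorm (0 : 'cV[R]_n) = 0.
Proof. by rewrite -(scale0r 0) vnormZ normr0 mul0r. Qed.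

Lemma vnorm_eq0 x : vnorm x = 0 -> x = 0.
Proof.
move=> x0; have := sqr_vnorm x; rewrite x0 expr0n/= => /esym/eqP.
rewrite psumr_eq0 => [/allP h|i _]; last by rewrite -expr2 sqr_ge0.
apply/colP => i; rewrite mxE; apply/eqP.
by have := h i (mem_index_enum _); rewrite /= mulf_eq0 orbb.
Qed.

(** Cauchy-Schwarz: expand the square of |y| x - |x| y, which is nonnegative, and divide by |x| |y|
    when neither vanishes. *)
Lemma vdot_le x y : vdot x y <= vnorm x * vnorm y.
Proof.
have [x0|x0] := eqVneq (vnorm x) 0.
  rewrite x0 mul0r /vdot big1// => i _.
  by rewrite (vnorm_eq0 _ x0) mxE mul0r.
have [y0|y0] := eqVneq (vnorm y) 0.
  rewrite y0 mulr0 /vdot big1// => i _.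
  by rewrite (vnorm_eq0 _ y0) mxE mulr0.
have xy0 : 0 < vnorm x * vnorm y by rewrite mulr_gt0// lt0r vnorm_ge0 ?x0 ?y0.
rewrite -subr_ge0 -(pmulr_rge0 _ xy0).
have := vdotxx_ge0 (vnorm y *: x - vnorm x *: y).
rewrite -scaleNr vdotDr !vdotZr ![vdot (_ + _) _]vdotC !vdotDr !vdotZr -!sqr_vnorm.
rewrite (vdotC y x); nra.
Qed.

(** Testing with z = x suffices. Through this duality, norm bounds for sums, matrix products and
    integrals reduce to scalar ones that are linear in the vector. *)
Lemma vnorm_le_dual C x :
  0 <= C -> (forall z, vdot z x <= C * vnorm z) -> vnorm x <= C.
Proof.
move=> C0 /(_ x); rewrite -sqr_vnorm expr2.
have [->//|x0] := eqVneq (vnorm x) 0.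
by rewrite ler_pM2r// lt0r x0 vnorm_ge0.
Qed.

Lemma vnormD x y : vnorm (x + y) <= vnorm x + vnorm y.
Proof.
apply: vnorm_le_dual; first by rewrite addr_ge0 ?vnorm_ge0.
move=> z; rewrite vdotDr mulrDl ![_ * vnorm z]mulrC.
by rewrite lerD ?vdot_le.
Qed.

(** A crude bound by row norms; it serves to make the supremum in [mnorm] one of a bounded set,
    hence a genuine one. *)
Lemma mulmx_vnorm_bounded (A : 'M[R]_n) :
  exists2 M, 0 <= M & forall x, vnorm (A *m x) <= M * vnorm x.
Proof.
exists (\sum_i vnorm (row i A)^T); first by apply: sumr_ge0 => i _; exact: vnorm_ge0.
move=> x; apply: vnorm_le_dual.
  by rewrite mulr_ge0 ?vnorm_ge0//; apply: sumr_ge0 => i _; exact: vnorm_ge0.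
move=> z; rewrite -mulrA mulr_suml; apply: ler_sum => i _.
have -> : (A *m x) i ord0 = vdot (row i A)^T x.
  by rewrite mxE; apply: eq_bigr => j _; rewrite !mxE.
have zi : `|z i ord0| <= vnorm z.
  rewrite -sqrtr_sqr vnormE ler_wsqrtr// /vdot (bigD1 i)//= -expr2 lerDl.
  by apply: sumr_ge0 => j _; rewrite -expr2 sqr_ge0.
have dxy : `|vdot (row i A)^T x| <= vnorm (row i A)^T * vnorm x.
  rewrite ler_norml vdot_le andbT lerNl.
  by rewrite -mulN1r -vdotZr (le_trans (vdot_le _ _))// vnormZ normrN1 mul1r.
rewrite (le_trans (ler_norm _))// normrM mulrA mulrC.
by rewrite ler_pM.
Qed.

Lemma mnorm_has_sup (A : 'M[R]_n) :
  has_sup [set vnorm (A *m x) | x in [set x : 'cV[R]_n | vnorm x <= 1]].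
Proof.
split; first by exists (vnorm (A *m 0)); exists 0; rewrite //= vnorm0.
have [M M0 hM] := mulmx_vnorm_bounded A.
exists M => _ [x /= x1 <-]; rewrite (le_trans (hM x))//.
by rewrite ler_piMr.
Qed.

Lemma mnorm_ge0 (A : 'M[R]_n) : 0 <= mnorm A.
Proof.
apply: (ub_le_sup (mnorm_has_sup A).2).
by exists 0; rewrite /= ?mulmx0 vnorm0.
Qed.

Lemma vnorm_mulmx_le (A : 'M[R]_n) x : vnorm (A *m x) <= mnorm A * vnorm x.
Proof.
have [x0|x0] := eqVneq (vnorm x) 0.
  by rewrite (vnorm_eq0 _ x0) mulmx0 vnorm0 mulr0.
have {}x0 : 0 < vnorm x by rewrite lt0r x0 vnorm_ge0.
rewrite -ler_pdivrMr//.
have -> : vnorm (A *m x) / vnorm x = vnorm (A *m ((vnorm x)^-1 *: x)).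
  by rewrite -scalemxAr vnormZ gtr0_norm ?invr_gt0// mulrC.
apply: (ub_le_sup (mnorm_has_sup A).2); exists ((vnorm x)^-1 *: x) => //=.
by rewrite vnormZ gtr0_norm ?invr_gt0// mulVf// gt_eqF.
Qed.

Lemma continuous_vnorm (T : topologicalType) (g : T -> 'cV[R]_n) :
  (forall i, continuous (fun s => g s i ord0)) -> continuous (fun s => vnorm (g s)).
Proof.
move=> cg s; apply: (@continuous_comp _ _ _ (fun s => \sum_(i < n) (g s i ord0) ^+ 2)
  Num.sqrt); last exact: sqrt_continuous.
by apply: continuous_sumr => i {}s; apply: cvgM; exact: cg.
Qed.

End vnorm.

Section vnorm_integral.
Context d (T : measurableType d) (R : realType) (mu : {measure set T -> \bar R}).
Context (n : nat) (D : set T) (mD : measurable D).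

Lemma integrable_sumr (I : Type) (s : seq I) (h : I -> T -> R) :
  (forall i, mu.-integrable D (EFin \o h i)) ->
  mu.-integrable D (EFin \o (fun x => \sum_(i <- s) h i x)).
Proof.
move=> ih; rewrite (_ : _ \o _ = fun x => (\sum_(i <- s) (h i x)%:E)%E).
  by apply: integrable_sum => // i _; exact: ih.
by apply/funext => x /=; rewrite sumEFin.
Qed.

Lemma Rintegral_sum (I : Type) (s : seq I) (h : I -> T -> R) :
  (forall i, mu.-integrable D (EFin \o h i)) ->
  \int[mu]_(x in D) (\sum_(i <- s) h i x) = \sum_(i <- s) \int[mu]_(x in D) h i x.
Proof.
move=> ih; elim: s => [|i s IH].
  rewrite big_nil; under eq_Rintegral do rewrite big_nil.
  by rewrite /Rintegral integral0.
rewrite big_cons -IH -RintegralD//; last exact: integrable_sumr.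
by apply: eq_Rintegral => x _; rewrite big_cons.
Qed.

(** For every z, linearity and Cauchy-Schwarz give z . int g = int z . g <= |z| int |g|, and duality
    concludes. *)
Lemma vnorm_Rintegral_le (g : T -> 'cV[R]_n) :
  (forall i, mu.-integrable D (EFin \o (fun x => g x i ord0))) ->
  mu.-integrable D (EFin \o (fun x => vnorm (g x))) ->
  vnorm (\col_i \int[mu]_(x in D) (g x i ord0)) <= \int[mu]_(x in D) vnorm (g x).
Proof.
move=> ig ing; apply: vnorm_le_dual.
  by apply: Rintegral_ge0 => x _; exact: vnorm_ge0.
move=> z.
have izg i : mu.-integrable D (EFin \o (fun x => z i ord0 * g x i ord0)).
  apply: eq_integrable (integrableZl mD (z i ord0) (ig i)) => //.
have -> : vdot z (\col_i \int[mu]_(x in D) (g x i ord0)) =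
    \int[mu]_(x in D) vdot z (g x).
  rewrite Rintegral_sum//; apply: eq_bigr => i _.
  by rewrite mxE RintegralZl.
rewrite -RintegralZr//; apply: le_Rintegral => //.
- exact: integrable_sumr.
- apply: eq_integrable (integrableZr mD (vnorm z) ing) => //.
- by move=> x _; rewrite mulrC vdot_le.
Qed.
End vnorm_integral.

(** * Convexity, strict Gronwall and elementary integrals *)

Section scalar.
Context {R : realType}.
Notation leb := (@lebesgue_measure R).

(** Jensen's inequality for w^r with three equal weights; 3^(r-1) is 3^r divided by 3. *)
Lemma powR_add3_le (r x y z : R) : 1 < r -> 0 <= x -> 0 <= y -> 0 <= z ->
  (x + y + z) `^ r <= 3 `^ (r - 1) * (x `^ r + y `^ r + z `^ r).
Proof.
move=> r1 x0 y0 z0; have r0 : 0 < r by lra.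
pose q := r / (r - 1).
have q0 : 0 < q by rewrite divr_gt0// subr_gt0.
have rq : r^-1 + q^-1 = 1 by rewrite /q; field; rewrite !gt_eqF//; lra.
pose m := (x + y + z) / 3.
have m0 : 0 <= m by rewrite /m; lra.
(* Young's inequality at the mean [m] is the tangent-line bound for [w `^ r]. *)
have young w : 0 <= w -> w * m `^ (r - 1) <= w `^ r / r + m `^ r / q.
  move=> w0; have := conjugate_powR w0 (powR_ge0 m (r - 1)) r0 q0 rq.
  rewrite -powRrM (_ : (r - 1) * q = r)//.
  by rewrite /q; field; rewrite gt_eqF// subr_gt0.
have mm : m * m `^ (r - 1) = m `^ r by rewrite mulr_powRB1.
have e3 : x + y + z = 3 * m by rewrite /m; field.
rewrite e3 powRM// -(mulr_powRB1 _ r0)//.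
rewrite (mulrC 3) -mulrA ler_pM2l ?powR_gt0//.
have := young _ x0; have := young _ y0; have := young _ z0.
have iq : q^-1 = 1 - r^-1 by lra.
have ir : 0 < r^-1 by rewrite invr_gt0.
move: (m `^ (r-1)) mm => P mm hz hy hx.
(* The three tangent bounds are added; since x + y + z = 3 m, m P = m^r and 1/q = 1 - 1/r, what
   remains is 3 m^r / r <= (x^r + y^r + z^r) / r. *)
have : (x + y + z) * P <= (x `^ r + y `^ r + z `^ r) / r + 3 * (m `^ r / q) by lra.
rewrite e3 -mulrA mm iq -(ler_pM2r ir); nra.
Qed.

(** At the first point m where D <= 0, D has been positive on [0, m), so the integral up to m is
    positive and forces D m > 0, a contradiction. *)
Lemma strict_gronwall (D : R -> R) (psi T : R) : continuous D -> 0 < psi -> 0 < D 0 ->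
  (forall t, 0 <= t <= T -> psi * \int[leb]_(s in `[0, t]) D s <= D t) ->
  forall t, 0 <= t <= T -> 0 < D t.
Proof.
move=> cD psi0 D0 hD t /andP[t0 tT]; rewrite ltNge; apply/negP => Dt.
pose S := [set s | 0 <= s <= T /\ D s <= 0].
have St : S t by rewrite /S/= t0 tT.
have lbS : has_lbound S by exists 0 => s [/andP[]].
have infS : has_inf S by split => //; exists t.
pose m := inf S.
have m_ge0 : 0 <= m by apply: lb_le_inf; [exists t | move=> s [/andP[]]].
have mt : m <= t by apply: ge_inf.
have pos s : 0 <= s < m -> 0 < D s.
  move=> /andP[s0 sm]; rewrite ltNge; apply/negP => Ds.
  have : S s by rewrite /S/= s0 Ds (le_trans (ltW sm))// (le_trans mt).
  by move/(ge_inf lbS); rewrite leNgt sm.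
have nearpos x : 0 < D x -> exists2 e, 0 < e & forall y, `|x - y| < e -> D x / 2 < D y.
  move=> Dx0; have /cvgrPdist_lt/(_ (D x / 2)) := cD x.
  rewrite divr_gt0// => /(_ isT)/nbhs_ballP[e /= e0 he].
  exists e => // y /he /=; rewrite ltr_norml => /andP[_]; lra.
have Dm : D m <= 0.
  rewrite leNgt; apply/negP => Dm0; have [e e0 he] := nearpos _ Dm0.
  have [s Ss sme] := inf_adherent e0 infS.
  have ms : m <= s := ge_inf lbS Ss.
  have : `|m - s| < e by rewrite distrC ger0_norm ?subr_ge0// ltrBlDl.
  by move=> /he; move: Ss => [_ Ds]; lra.
have m0 : 0 < m.
  by rewrite lt_neqAle m_ge0 andbT; apply/eqP => m0; move: Dm D0; rewrite -m0; lra.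
have [e e0 he] := nearpos _ D0.
(* On [0, eta] the function stays above D 0 / 2, which makes the integral strictly positive; the
   bound m / 2 keeps this interval inside [0, m). *)
pose eta := Num.min (e / 2) (m / 2).
have eta0 : 0 < eta by rewrite lt_min !divr_gt0.
have etae : eta < e by rewrite gt_min; apply/orP; left; lra.
have etam : eta < m by rewrite gt_min; apply/orP; right; lra.
have iD : leb.-integrable `[0, m[ (EFin \o D).
  apply: integrableS (continuous_integrable D 0 m cD) => //.
  by apply: subset_itvl; rewrite bnd_simp.
have iD' : leb.-integrable `[0, eta] (EFin \o D) by exact: continuous_integrable.
have ge1 : D 0 / 2 * eta <= \int[leb]_(s in `[0, eta]) D s.
  have -> : D 0 / 2 * eta = \int[leb]_(s in `[0, eta]) (D 0 / 2).
    by rewrite Rintegral_cst//= lebesgue_measure_itv/= lte_fin eta0/= subr0.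
  apply: le_Rintegral => //.
    exact: (@continuous_integrable _ (fun=> D 0 / 2) _ _ (fun=> cvg_cst _)).
  move=> s; rewrite /= in_itv/= => /andP[s0 seta]; apply/ltW/he.
  by rewrite sub0r normrN ger0_norm//; exact: le_lt_trans etae.
have ge2 : 0 <= \int[leb]_(s in `]eta, m[) D s.
  apply: Rintegral_ge0 => s; rewrite /= in_itv/= => /andP[es sm].
  by apply/ltW/pos; rewrite sm andbT (le_trans (ltW eta0))// ltW.
have := @Rintegral_itvB _ _ (BLeft 0) (BLeft m) eta iD.
rewrite !bnd_simp (ltW eta0) etam => /(_ isT isT) split.
have := hD m; rewrite m_ge0 (le_trans mt)// => /(_ isT).
rewrite -Rintegral_itv_bndo_bndc//.
have De : 0 < D 0 / 2 * eta by rewrite mulr_gt0// divr_gt0.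
have I0 : 0 < \int[leb]_(s in `[0, m[) D s.
  by move/eqP: split; rewrite subr_eq => /eqP ->; rewrite ltr_wpDl// (lt_le_trans De).
by apply/negP; rewrite -ltNge (le_lt_trans Dm)// mulr_gt0.
Qed.

Lemma Rintegral_expRM (c a b : R) : c != 0 -> a <= b ->
  \int[leb]_(s in `[a, b]) expR (c * s) = (expR (c * b) - expR (c * a)) / c.
Proof.
move=> c0; rewrite le_eqVlt => /predU1P[->|ab].
  by rewrite set_itv1 Rintegral_set1 subrr mul0r.
have dF (x : R) : is_derive x (1 : R) (fun x => expR (c * x) / c) (expR (c * x)).
  rewrite (_ : (fun x => _) = c^-1 *: (fun y : R => expR (c * y))); last first.
    by apply/funext => y /=; rewrite mulrC.
  have hl : is_derive x (1 : R) (fun y : R => c * y) c.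
    rewrite -[X in is_derive _ _ _ X]mulr1 -[X in is_derive _ _ _ X]/(c *: (1:R)).
    exact: is_deriveZ.
  have he := @is_derive1_comp R expR (fun y => c * y) x _ _ _ hl.
  have := is_deriveZ c^-1 (he _ (is_derive_expR _)).
  by rewrite /= /GRing.scale/= mulrCA mulVf// mulr1.
have cF : continuous (fun x : R => expR (c * x) / c).
  move=> x; apply/differentiable_continuous/derivable1_diffP.
  exact: (@ex_derive _ _ _ _ _ _ _ (dF x)).
rewrite /Rintegral (@continuous_FTC2 _ _ (fun x => expR (c * x) / c))//.
- by rewrite -EFinB /= mulrBl.
- by apply: continuous_subspaceT; exact: continuous_expRM.
- split.
  + by move=> x _; apply: (@ex_derive _ _ _ _ _ _ _ (dF x)).
  + by apply/cvg_at_right_filter; exact: cF.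
  + by apply/cvg_at_left_filter; exact: cF.
- by move=> x _; rewrite derive1E; apply: (@derive_val _ _ _ _ _ _ _ (dF x)).
Qed.

Lemma Rintegral_shift (w : R -> R) (tau t : R) : continuous w -> (forall s, 0 <= w s) ->
  \int[leb]_(s in `[0, t]) w (s - tau) = \int[leb]_(s in `[- tau, t - tau]) w s.
Proof.
move=> cw w0; rewrite /Rintegral; congr fine.
rewrite [RHS](@ge0_integral_affine _ 1 (- tau)) ?oner_neq0//; last 2 first.
- by apply/measurable_EFinP/measurable_funTS; exact: continuous_measurable_fun.
- by move=> x _; rewrite lee_fin.
rewrite normr1 mul1e.
have -> : affine 1 (- tau) @^-1` `[- tau, t - tau]%classic = `[0, t]%classic.
  apply/seteqP; split=> x /=; rewrite !in_itv/= /affine mul1r => /andP[h1 h2];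
  apply/andP; split; lra.
by apply: eq_integral => x _; rewrite mul1r.
Qed.
End scalar.

(** * Integrability against the kernel and the delayed weighted integral *)

Section weighted_integrals.
Context {R : realType}.
Notation leb := (@lebesgue_measure R).

(** The kernel times e^s has a finite integral by the Gamma bound with k = 1, and the remaining
    factor e^(-s) u is bounded on the compact interval. *)
Lemma kernel_integrable (alpha t : R) (u : R -> R) : 0 < alpha <= 1 -> continuous u ->
  leb.-integrable `[0, t] (EFin \o (fun s => (t - s) `^ (alpha - 1) * u s)).
Proof.
move=> a01 cu.
have iK : leb.-integrable `[0, t] (EFin \o (fun s => (t - s) `^ (alpha - 1) * expR (1 * s))).
  apply/integrableP; split.
    apply/measurable_EFinP; apply: measurable_funM; first exact: measurable_powR_subr.
    exact: measurable_expRM.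
  apply: le_lt_trans (ltry (expR (1 * t) * Gamma alpha / 1 `^ alpha)).
  apply: le_trans (kernel_integral_le alpha 1 t a01 ltr01).
  rewrite le_eqVlt; apply/orP; left; apply/eqP; apply: eq_integral => s _ /=.
  by rewrite ger0_norm// mulr_ge0 ?powR_ge0 ?expR_ge0.
have ch : continuous (fun s => expR (- s) * u s).
  move=> s; apply: cvgM; last exact: cu.
  by apply: continuous_comp; [exact: opp_continuous | exact: continuous_expR].
have bh : [bounded (fun s => expR (- s) * u s) s | s in `[0, t]%classic].
  have [M [Mr hM]] := compact_bounded (continuous_compact
    (continuous_subspaceT ch) (@segment_compact R 0 t)).
  by exists M; split => // x Mx s st; apply: (hM x Mx); exists s.
have mh : measurable_fun `[0, t]%classic (fun s => expR (- s) * u s).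
  by apply/measurable_funTS; exact: continuous_measurable_fun.
apply: eq_integrable (integrableMl _ iK mh bh) => //= s _.
rewrite -EFinM mul1r expRN; congr EFin; field.
by rewrite gt_eqF ?expR_gt0.
Qed.

Lemma le_Rintegral_continuous (f g : R -> R) (a b : R) : continuous f -> continuous g ->
  (forall x, a <= x <= b -> f x <= g x) ->
  \int[leb]_(x in `[a, b]) f x <= \int[leb]_(x in `[a, b]) g x.
Proof.
by move=> cf cg fg; apply: le_Rintegral => //; exact: continuous_integrable.
Qed.

Lemma Rintegral_itv_split (f : R -> R) (a b c : R) : continuous f -> a <= b -> b <= c ->
  \int[leb]_(x in `[a, c]) f x =
  \int[leb]_(x in `[a, b]) f x + \int[leb]_(x in `[b, c]) f x.
Proof.
move=> cf ab bc.
have iac := continuous_integrable f a c cf.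
have := @Rintegral_itvB _ f (BLeft a) (BRight c) b iac.
rewrite !bnd_simp => /(_ ab bc); rewrite Rintegral_itv_obnd_cbnd.
  by move/eqP; rewrite subr_eq addrC => /eqP.
apply: integrableS iac => //.
by apply: subset_itvr; rewrite bnd_simp.
Qed.

Section weighted.
Context (r : R) (N : R -> R).
Context (r0 : 0 < r) (cN : continuous N) (N0 : forall s, 0 <= N s).
Let v (s : R) := expR (- (r * s)) * N s `^ r.

Lemma continuous_weighted : continuous v.
Proof.
by move=> s; apply: cvgM; [exact: continuous_expRNM | exact: continuous_powR_ge0].
Qed.

(** Shifting s by tau yields e^(-r tau) times the integral of [v] over [-tau, t - tau]. Enlarging it
    to [-tau, t] avoids a case split on t < tau; the history part is at most c^r (e^(r tau) - 1) /
    r. *)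
Lemma delay_integral_le (tau c t : R) : 0 <= tau -> 0 <= t ->
  (forall s, - tau <= s <= 0 -> N s <= c) ->
  \int[leb]_(s in `[0, t]) (expR (- (r * s)) * N (s - tau) `^ r) <=
  expR (- (r * tau)) * \int[leb]_(s in `[0, t]) v s
  + c `^ r * (1 - expR (- (r * tau))) / r.
Proof.
move=> tau0 t0 Nc.
have cv := continuous_weighted.
have v0 s : 0 <= v s by rewrite mulr_ge0 ?expR_ge0 ?powR_ge0.
have cvs : continuous (fun s => v (s - tau)).
  move=> s; apply: (@continuous_comp _ _ _ (fun s => s - tau) v); [|exact: cv].
  by apply: cvgB; [exact: cvg_id | exact: cvg_cst].
have -> : \int[leb]_(s in `[0, t]) (expR (- (r * s)) * N (s - tau) `^ r) =
    expR (- (r * tau)) * \int[leb]_(s in `[- tau, t - tau]) v s.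
  rewrite -Rintegral_shift// -RintegralZl//; last exact: continuous_integrable.
  apply: eq_Rintegral => s _; rewrite /v mulrA -expRD.
  by congr (expR _ * _); ring.
have le1 : \int[leb]_(s in `[- tau, t - tau]) v s <= \int[leb]_(s in `[- tau, t]) v s.
  rewrite [leRHS](Rintegral_itv_split _ _ (t - tau)) ?lerDl ?Rintegral_ge0//; lra.
have sp : \int[leb]_(s in `[- tau, t]) v s =
  \int[leb]_(s in `[- tau, 0]) v s + \int[leb]_(s in `[0, t]) v s.
  by apply: Rintegral_itv_split => //; lra.
have le2 : \int[leb]_(s in `[- tau, 0]) v s <= c `^ r * ((expR (r * tau) - 1) / r).
  have ce : continuous (fun s => c `^ r * expR (- r * s)).
    by move=> s; apply: cvgM; [exact: cvg_cst | exact: continuous_expRM].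
  apply: (@le_trans _ _ (\int[leb]_(s in `[- tau, 0]) (c `^ r * expR (- r * s)))).
    apply: le_Rintegral_continuous => // s st.
    rewrite /v mulrC mulNr ler_pM2r ?expR_gt0//.
    have Nsc := Nc s st.
    apply: (ge0_ler_powR (ltW r0)); rewrite ?nnegrE //.
    exact: le_trans (N0 s) Nsc.
  rewrite RintegralZl//; last exact/continuous_integrable/continuous_expRM.
  rewrite Rintegral_expRM ?oppr_eq0 ?gt_eqF//; last lra.
  rewrite mulr0 expR0 mulrNN invrN mulrN -mulNr opprB; exact: lexx.
have e0 : 0 < expR (- (r * tau)) by exact: expR_gt0.
apply: (@le_trans _ _ (expR (- (r * tau)) * (c `^ r * ((expR (r * tau) - 1) / r) +
   \int[leb]_(s in `[0, t]) v s))).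
  by rewrite ler_pM2l// (le_trans le1)// sp lerD2r.
rewrite mulrDr addrC lerD2l le_eqVlt; apply/orP; left; apply/eqP.
have -> : expR (r * tau) = (expR (- (r * tau)))^-1 by rewrite expRN invrK.
by field; rewrite !gt_eqF.
Qed.

End weighted.
End weighted_integrals.

(** * The scalar delay inequality and its explicit bound *)

Section scalar_bound.
Context {R : realType}.
Notation leb := (@lebesgue_measure R).

(** The right-hand side U satisfies the integral inequality with equality: U' = psi U - p r e^(-r t)
    and U 0 = p + q. Thus U - v meets the hypotheses of [strict_gronwall]. *)
Lemma affine_gronwall (v : R -> R) (r psi p q T : R) :
  continuous v -> 0 < r -> 0 < psi -> v 0 < p + q ->
  (forall t, 0 <= t <= T ->
    v t <= p * expR (- r * t) + q + psi * \int[leb]_(s in `[0, t]) v s) ->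
  forall t, 0 <= t <= T ->
    v t < p * r / (r + psi) * expR (- r * t) + (p * psi / (r + psi) + q) * expR (psi * t).
Proof.
move=> cv r0 psi0 v0 hv t ht.
(* [P] is the coefficient of the particular solution in e^(-r t); [Q] is p + q - P, fixed by the
   value at 0. *)
pose P := p * r / (r + psi); pose Q := p * psi / (r + psi) + q.
have rpsi : 0 < r + psi by rewrite addr_gt0.
have rpsi0 : r + psi != 0 by rewrite gt_eqF.
have cP : continuous (fun s => P * expR (- r * s)).
  by move=> s; apply: cvgM; [exact: cvg_cst | exact: continuous_expRM].
have cQ : continuous (fun s => Q * expR (psi * s)).
  by move=> s; apply: cvgM; [exact: cvg_cst | exact: continuous_expRM].
have cU : continuous (fun s => P * expR (- r * s) + Q * expR (psi * s)).
  by move=> s; apply: cvgD; [exact: cP | exact: cQ].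
have PQ : P + Q = p + q by rewrite /P /Q; field.
rewrite -subr_gt0 -/P -/Q.
apply: (strict_gronwall
  (fun s => P * expR (- r * s) + Q * expR (psi * s) - v s) psi T) => //.
- by move=> s; apply: cvgB; [exact: cU | exact: cv].
- by rewrite !mulr0 expR0 !mulr1 PQ subr_gt0.
- move=> {ht}t ht; have /andP[t0 _] := ht.
  rewrite RintegralB//; [|exact: continuous_integrable..].
  rewrite RintegralD//; [|exact: continuous_integrable..].
  rewrite !RintegralZl//; [|exact/continuous_integrable/continuous_expRM..].
  rewrite !Rintegral_expRM ?oppr_eq0 ?gt_eqF// !mulr0 expR0.
  apply: le_trans (lerB (lexx _) (hv t ht)).
  rewrite le_eqVlt; apply/orP; left; apply/eqP; rewrite /P /Q.
  by field; rewrite rpsi0 !gt_eqF.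
Qed.

Lemma fractional_delay_bound (N : R -> R) (alpha r k T tau c a b K : R) :
  0 < alpha < 1 -> k = 1 + alpha -> r = 1 + alpha^-1 ->
  0 <= tau -> 0 < c -> 0 < a -> 0 <= b -> 0 < K ->
  continuous N -> (forall s, 0 <= N s) -> (forall s, - tau <= s <= 0 -> N s <= c) ->
  (forall t, 0 <= t <= T ->
    N t <= c + K * \int[leb]_(s in `[0, t])
                     ((t - s) `^ (alpha - 1) * (a * N s + b * N (s - tau)))) ->
  let omega := (Gamma (alpha ^+ 2) / k `^ (alpha ^+ 2)) `^ (k^-1) in
  let psi := 3 `^ (alpha^-1) * (a `^ r + b `^ r * expR (- (r * tau)))
             * omega `^ r * K `^ r in
  let phi := 3 `^ (alpha^-1) * b `^ r * (1 - expR (- (r * tau))) / r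
             * omega `^ r * K `^ r in
  forall t, 0 <= t <= T ->
  N t < c * ((3 `^ (alpha^-1) * r + (3 `^ (alpha^-1) * psi + r * phi + psi * phi)
             * expR ((psi + r) * t)) / (r + psi)) `^ (r^-1).
Proof.
move=> a01 kE rE tau0 c0 a0 b0 K0 cN N0 Nc hN omega psi phi.
have /andP[al0 al1] := a01.
have r0 : 0 < r by rewrite rE addr_gt0 ?invr_gt0.
have r1 : 1 < r by rewrite rE ltrDl invr_gt0.
have k0 : 0 < k by rewrite kE; lra.
have rm1 : r - 1 = alpha^-1 by rewrite rE addrC addKr.
(* Source of the strictness: since this constant exceeds 1, the comparison function starts strictly
   above c^r. *)
have C1 : 1 < 3 `^ alpha^-1 :> R.
  have : (1 : R) `^ alpha^-1 < 3 `^ alpha^-1.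
    by apply: gt0_ltr_powR; rewrite ?invr_gt0 ?nnegrE//; lra.
  by rewrite powR1.
set C := 3 `^ alpha^-1 in C1 psi phi *.
have C0 : 0 < C by lra.
have al2 : 0 < alpha ^+ 2 <= 1 by rewrite exprn_gt0//= expr_le1// ltW.
have omega0 : 0 < omega by rewrite powR_gt0// divr_gt0 ?Gamma_gt0 ?powR_gt0.
have e01 : 0 <= 1 - expR (- (r * tau)).
  by rewrite subr_ge0 expR_le1 oppr_le0 mulr_ge0// ltW.
have psi0 : 0 < psi.
  have ab : 0 < a `^ r + b `^ r * expR (- (r * tau)).
    by apply: ltr_wpDr; rewrite ?mulr_ge0 ?powR_ge0 ?expR_ge0 ?powR_gt0.
  by rewrite /psi !mulr_gt0// powR_gt0.
have phi0 : 0 <= phi.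
  by rewrite /phi !mulr_ge0 ?invr_ge0 ?powR_ge0// ltW.
have cr0 : 0 < c `^ r by rewrite powR_gt0.
pose v s := expR (- (r * s)) * N s `^ r.
have cv : continuous v := continuous_weighted r N r0 cN N0.
have v0 s : 0 <= v s by rewrite mulr_ge0 ?expR_ge0 ?powR_ge0.
have cNd : continuous (fun s => N (s - tau)).
  move=> s; apply: (@continuous_comp _ _ _ (fun s => s - tau) N); [|exact: cN].
  by apply: cvgB; [exact: cvg_id | exact: cvg_cst].
have hv t : 0 <= t <= T ->
    v t <= (c `^ r * C) * expR (- r * t) + c `^ r * phi + psi * \int[leb]_(s in `[0, t]) v s.
  move=> ht; have /andP[t0 _] := ht.
  pose J1 := \int[leb]_(s in `[0, t]) ((t - s) `^ (alpha - 1) * N s).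
  pose J2 := \int[leb]_(s in `[0, t]) ((t - s) `^ (alpha - 1) * N (s - tau)).
  pose X := \int[leb]_(s in `[0, t]) v s.
  pose Y := \int[leb]_(s in `[0, t]) (expR (- (r * s)) * N (s - tau) `^ r).
  have I1 : J1 <= omega * expR t * X `^ r^-1.
    exact: (hoelder_kernel alpha k r t N a01 cN N0 kE rE).
  have I2 : J2 <= omega * expR t * Y `^ r^-1.
    exact: (hoelder_kernel alpha k r t _ a01 cNd (fun s => N0 (s - tau)) kE rE).
  have Yle : Y <= expR (- (r * tau)) * X + c `^ r * (1 - expR (- (r * tau))) / r.
    exact: (delay_integral_le r N r0 cN N0 tau c t tau0 t0 Nc).
  have X0 : 0 <= X by apply: Rintegral_ge0.
  have Y0 : 0 <= Y.
    by apply: Rintegral_ge0 => s _; rewrite mulr_ge0 ?expR_ge0 ?powR_ge0.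
  have Nt : N t <= c + K * (a * J1 + b * J2).
    have a01' : 0 < alpha <= 1 by rewrite al0 ltW.
    have iN1 := kernel_integrable alpha t N a01' cN.
    have iN2 := kernel_integrable alpha t _ a01' cNd.
    apply: (le_trans (hN t ht)); rewrite lerD2l ler_pM2l//.
    rewrite /J1 /J2 -!RintegralZl// -RintegralD//.
    - rewrite le_eqVlt; apply/orP; left; apply/eqP.
      by apply: eq_Rintegral => s _; ring.
    - by apply: eq_integrable (integrableZl _ a iN1).
    - by apply: eq_integrable (integrableZl _ b iN2).
  rewrite -/X /v; move: X Y J1 J2 I1 I2 Yle X0 Y0 Nt => X Y J1 J2 I1 I2 Yle X0 Y0 Nt.
  have et : 0 < expR t by exact: expR_gt0.
  have Nt' : N t <= c + K * a * omega * expR t * X `^ r^-1 +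
                        K * b * omega * expR t * Y `^ r^-1.
    apply: (le_trans Nt); rewrite -addrA lerD2l.
    rewrite mulrDr; apply: lerD.
      by rewrite -!mulrA !ler_pM2l// mulrA.
    rewrite -!mulrA ler_pM2l//; by apply: ler_wpM2l; rewrite // mulrA.
  have Xr : (X `^ r^-1) `^ r = X by rewrite -powRrM mulVf ?gt_eqF// powRr1.
  have Yr : (Y `^ r^-1) `^ r = Y by rewrite -powRrM mulVf ?gt_eqF// powRr1.
  have A0 : 0 <= K * a * omega * expR t by rewrite !mulr_ge0// ltW.
  have B0 : 0 <= K * b * omega * expR t by rewrite !mulr_ge0// ltW.
  have : N t `^ r <= C * (c `^ r + K `^ r * a `^ r * omega `^ r * expR (r * t) * X +
                          K `^ r * b `^ r * omega `^ r * expR (r * t) * Y).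
    have -> : K `^ r * a `^ r * omega `^ r * expR (r * t) * X =
              (K * a * omega * expR t * X `^ r^-1) `^ r.
      by rewrite powRM ?powR_ge0// Xr !powRM ?mulr_ge0 ?expR_ge0// ?ltW// -expRM (mulrC t).
    have -> : K `^ r * b `^ r * omega `^ r * expR (r * t) * Y =
              (K * b * omega * expR t * Y `^ r^-1) `^ r.
      rewrite powRM ?powR_ge0// Yr.
      by rewrite !powRM ?mulr_ge0 ?expR_ge0// ?(ltW K0) ?(ltW omega0)// -expRM (mulrC t).
    rewrite /C -rm1; apply: le_trans (powR_add3_le _ _ _ _ r1 (ltW c0) _ _).
    - apply: (ge0_ler_powR (ltW r0)); rewrite ?nnegrE//.
      by rewrite !addr_ge0 ?mulr_ge0 ?powR_ge0 ?expR_ge0// ltW.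
    - by rewrite mulr_ge0// powR_ge0.
    - by rewrite mulr_ge0// powR_ge0.
  have ert : 0 < expR (r * t) by exact: expR_gt0.
  move=> Nr; rewrite mulNr !expRN [leLHS]mulrC.
  rewrite ler_pdivrMr//.
  apply: (le_trans Nr).
  rewrite !mulrDl.
  have -> : c `^ r * C * (expR (r * t))^-1 * expR (r * t) = C * c `^ r.
    by field; rewrite gt_eqF.
  (* The common factor of [psi] and [phi]; once it is extracted, the delay estimate for [Y] splits
     the coefficient of b^r between the two. *)
  pose kap := C * K `^ r * omega `^ r.
  have kap0 : 0 <= kap by rewrite !mulr_ge0 ?powR_ge0// ltW.
  have psiE : psi = kap * (a `^ r + b `^ r * expR (- (r * tau))) by rewrite /psi /kap; ring.
  have phiE : phi = kap * (b `^ r * (1 - expR (- (r * tau))) / r) by rewrite /phi /kap; ring.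
  rewrite psiE phiE.
  have -> : C * (c `^ r + K `^ r * a `^ r * omega `^ r * expR (r * t) * X +
      K `^ r * b `^ r * omega `^ r * expR (r * t) * Y) =
    C * c `^ r + kap * expR (r * t) * (a `^ r * X + b `^ r * Y) by rewrite /kap; ring.
  rewrite -addrA lerD2l.
  have bY : b `^ r * Y <= b `^ r * (expR (- (r * tau)) * X +
      c `^ r * (1 - expR (- (r * tau))) / r) by rewrite ler_wpM2l ?powR_ge0.
  apply: (@le_trans _ _ (kap * expR (r * t) * (a `^ r * X + b `^ r *
     (expR (- (r * tau)) * X + c `^ r * (1 - expR (- (r * tau))) / r)))).
    by apply: ler_wpM2l; [rewrite mulr_ge0 ?expR_ge0 | rewrite lerD2l].
  by rewrite le_eqVlt; apply/orP; left; apply/eqP; ring.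
have v0lt t : 0 <= t <= T -> v 0 < c `^ r * C + c `^ r * phi.
  move=> ht; rewrite /v mulr0 oppr0 expR0 mul1r.
  have : N 0 `^ r <= c `^ r.
    apply: (ge0_ler_powR (ltW r0)); rewrite ?nnegrE ?(ltW c0)//.
    by apply: Nc; rewrite lexx oppr_le0 tau0.
  have : c `^ r * 1 < c `^ r * C by rewrite ltr_pM2l.
  have : 0 <= c `^ r * phi by rewrite mulr_ge0// ltW.
  rewrite mulr1; lra.
move=> t ht.
pose M := (C * r + (C * psi + r * phi + psi * phi) * expR ((psi + r) * t)) / (r + psi).
have := affine_gronwall v r psi _ _ T cv r0 psi0 (v0lt t ht) hv t ht.
rewrite -/M.
have M0 : 0 <= M.
  have p0 : 0 <= C * psi + r * phi + psi * phi.
    by rewrite !addr_ge0// mulr_ge0// ltW.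
  apply: divr_ge0; last exact: ltW (addr_gt0 r0 psi0).
  by apply: addr_ge0; apply: mulr_ge0; rewrite // ?expR_ge0// ltW.
have ert : 0 < expR (r * t) by exact: expR_gt0.
(* Factoring e^(-r t) out of the Gronwall bound turns e^(psi t) into e^((psi + r) t), and the factor
   cancels against the one in [v]. *)
have -> : c `^ r * C * r / (r + psi) * expR (- r * t) +
    (c `^ r * C * psi / (r + psi) + c `^ r * phi) * expR (psi * t) =
    c `^ r * M * expR (- (r * t)).
  rewrite /M (mulrDl psi r t) expRD mulNr !expRN.
  field; rewrite !gt_eqF ?addr_gt0//.
rewrite /v mulrC ltr_pM2r ?expR_gt0// => NM.
rewrite ltNge; apply/negP => le.
have : (c * M `^ r^-1) `^ r <= N t `^ r.
  by apply: (ge0_ler_powR (ltW r0)); rewrite ?nnegrE ?mulr_ge0 ?powR_ge0// ltW.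
by rewrite powRM ?powR_ge0 ?(ltW c0)// -powRrM mulVf ?gt_eqF// powRr1// leNgt NM.
Qed.
End scalar_bound.

(** * Continuous extension by clamping, and bounds for the fractional integral and the history *)

Lemma continuous_comp_within (X Y Z : topologicalType) (A : set Y) (g : X -> Y) (F : Y -> Z) :
  {within A, continuous F} -> continuous g -> (forall x, A (g x)) -> continuous (F \o g).
Proof.
move=> /subspace_continuousP cF cg gA x; apply: cvg_comp (cF _ (gA x)).
by move=> U /= /(cg x); rewrite /nbhs/=; apply: filterS => z /(_ (gA z)).
Qed.

Section clamp.
Context {R : realType}.

Definition clamp (a b s : R) := Num.max a (Num.min s b).

Lemma clamp_itv a b s : a <= b -> a <= clamp a b s <= b.
Proof. by move=> ab; rewrite /clamp le_max lexx/= ge_max ab ge_min lexx orbT. Qed.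

Lemma clamp_id a b s : a <= s <= b -> clamp a b s = s.
Proof. by move=> /andP[sa sb]; rewrite /clamp (min_idPl sb) (max_idPr sa). Qed.

Lemma continuous_clamp a b : continuous (clamp a b).
Proof.
move=> s; apply: (@continuous_max R R (fun=> a) (fun s => Num.min s b) s).
  exact: cvg_cst.
by apply: (@continuous_min R R id (fun=> b) s); [exact: cvg_id | exact: cvg_cst].
Qed.
End clamp.

Section GPFI.
Context {R : realType} (n : nat).
Notation leb := (@lebesgue_measure R).

(** After the norm is moved under the integral, the tempering exponential is at most 1, because mu
    <= 1 and s <= t. *)
Lemma vnorm_GPFI_le (alpha mu t : R) (h : R -> 'cV[R]_n) :
  0 < alpha <= 1 -> 0 < mu <= 1 -> (forall i, continuous (fun s => h s i ord0)) ->
  vnorm (GPFI alpha mu h t) <= (mu `^ alpha * Gamma alpha)^-1 *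
    \int[leb]_(s in `[0, t]) ((t - s) `^ (alpha - 1) * vnorm (h s)).
Proof.
move=> a01 /andP[mu0 mu1] ch.
have K0 : 0 < (mu `^ alpha * Gamma alpha)^-1.
  by rewrite invr_gt0 mulr_gt0 ?powR_gt0 ?Gamma_gt0.
pose e s := expR ((mu - 1) / mu * (t - s)).
have ce : continuous e.
  move=> s; apply: (@continuous_comp _ _ _ (fun s => (mu - 1) / mu * (t - s)) expR).
    by apply: cvgM; [exact: cvg_cst | apply: cvgB; [exact: cvg_cst | exact: cvg_id]].
  exact: continuous_expR.
have cvh : continuous (fun s => vnorm (h s)) := continuous_vnorm _ h ch.
pose g s := (e s * (t - s) `^ (alpha - 1)) *: h s.
have vg s : vnorm (g s) = (t - s) `^ (alpha - 1) * (e s * vnorm (h s)).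
  rewrite vnormZ ger0_norm ?mulr_ge0 ?expR_ge0 ?powR_ge0//.
  by rewrite mulrAC mulrC mulrA.
have ig i : leb.-integrable `[0, t] (EFin \o (fun s => g s i ord0)).
  have ceh : continuous (fun s => e s * h s i ord0).
    by move=> s; apply: cvgM; [exact: ce | exact: ch].
  apply: eq_integrable (kernel_integrable alpha t _ a01 ceh) => // s _.
  by rewrite /g /= mxE; congr EFin; ring.
have ivg : leb.-integrable `[0, t] (EFin \o (fun s => vnorm (g s))).
  have ceh : continuous (fun s => e s * vnorm (h s)).
    by move=> s; apply: cvgM; [exact: ce | exact: cvh].
  apply: eq_integrable (kernel_integrable alpha t _ a01 ceh) => // s _.
  by rewrite /= vg.
have -> : GPFI alpha mu h t = (mu `^ alpha * Gamma alpha)^-1 *: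
    (\col_i \int[leb]_(s in `[0, t]) (g s i ord0)).
  apply/colP => i; rewrite !mxE; congr (_ * _).
  by apply: eq_Rintegral => s _; rewrite /g mxE.
rewrite vnormZ gtr0_norm// ler_pM2l//.
apply: (le_trans (vnorm_Rintegral_le _ _ _ _ _ _ _ _ ig ivg)) => //.
apply: le_Rintegral => //; first exact: kernel_integrable.
move=> s; rewrite /= in_itv/= => /andP[_ st].
rewrite vg ler_wpM2l ?powR_ge0// ler_piMl ?vnorm_ge0// expR_le1.
by rewrite mulr_le0_ge0 ?subr_ge0// mulr_le0_ge0 ?invr_ge0 ?subr_le0// ltW.
Qed.
End GPFI.

(** Compactness of [-tau, 0] bounds the set of norms, so the supremum in [Cnorm] is an upper
    bound. *)
Lemma vnorm_le_Cnorm (R : realType) (n : nat) (tau t : R) (phi : R -> 'cV[R]_n) :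
  {within `[- tau, 0], continuous phi} -> - tau <= t <= 0 -> vnorm (phi t) <= Cnorm tau phi.
Proof.
move=> cphi /[dup] tt /andP[tau_t t0].
have tau0 : - tau <= 0 := le_trans tau_t t0.
have cpc : continuous (fun s => vnorm (phi (clamp (- tau) 0 s))).
  apply: continuous_vnorm => i s.
  apply: (@continuous_comp _ _ _ (phi \o clamp (- tau) 0) (fun x => x i ord0)).
    apply: continuous_comp_within cphi _ _ s; first exact: continuous_clamp.
    by move=> x; rewrite /= in_itv/= clamp_itv.
  exact: coord_continuous.
have [M [_ hM]] := compact_bounded (continuous_compact
    (continuous_subspaceT cpc) (@segment_compact R (- tau) 0)).
apply: ub_le_sup; last by exists t; rewrite //= in_itv.
(* [compact_bounded] provides bounds only strictly above [M], hence the added 1. *)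
exists (M + 1) => _ [s st <-].
rewrite (le_trans (ler_norm _))//; apply: (hM (M + 1)); first by rewrite ltrDl.
by exists s => //=; rewrite clamp_id//; move: st; rewrite /= in_itv.
Qed.

(** * Finite-time stability of the delay system *)

Theorem theorem2 (R : realType) (n : nat) (alpha mu T tau Lf c1 c2 : R)
  (A B : 'M[R]_n) (phi : R -> 'cV[R]_n)
  (f : R -> 'cV[R]_n -> 'cV[R]_n -> 'cV[R]_n) (y : R -> 'cV[R]_n) :
  (0 < n)%N ->
  0 < alpha < 1 -> 0 < mu <= 1 -> 0 < T -> 0 < tau ->
  {within `[- tau, 0], continuous phi} ->
  {within [set p : R * ('cV[R]_n * 'cV[R]_n) | 0 <= p.1 <= T],
     continuous (fun p => f p.1 p.2.1 p.2.2)} ->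
  (forall t, 0 <= t <= T -> f t 0 0 = 0) ->
  0 < Lf ->
  (forall (u v : R -> 'cV[R]_n) t, 0 <= t <= T ->
     vnorm (f t (u t) (u (t - tau)) - f t (v t) (v (t - tau)))
       <= Lf * (vnorm (u t - v t) + vnorm (u (t - tau) - v (t - tau)))) ->
  0 < c1 -> 0 < c2 -> c1 <= c2 ->
  let k := 1 + alpha in
  let r := 1 + alpha^-1 in
  let omega := (Gamma (alpha ^+ 2) / k `^ (alpha ^+ 2)) `^ (k^-1) in
  let psi := 3 `^ (alpha^-1) *
      ((mnorm A + Lf) `^ r + (mnorm B + Lf) `^ r * expR (- (r * tau)))
      * omega `^ r / (mu `^ k * Gamma alpha `^ r) in
  let varphi := 3 `^ (alpha^-1) * (mnorm B + Lf) `^ r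
      * (1 - expR (- (r * tau))) / (r * mu `^ k * Gamma alpha `^ r)
      * omega `^ r in
  (forall t, 0 <= t <= T ->
     ((3 `^ (alpha^-1) * r
       + (3 `^ (alpha^-1) * psi + r * varphi + psi * varphi)
         * expR ((psi + r) * t)) / (r + psi)) `^ (r^-1) <= c2 / c1) ->
  mild_solution alpha mu T tau A B f phi y ->
  Cnorm tau phi <= c1 ->
  forall t, 0 <= t <= T -> vnorm (y t) < c2.
Proof.
move=> _ a01 mu01 T0 tau0 cphi cf f00 Lf0 hf c10 c20 c12 k r omega psi varphi hM
  [cy [yphi ysol]] phic1 t ht.
have /andP[al0 al1] := a01; have /andP[mu0 mu1] := mu01.
have a01' : 0 < alpha <= 1 by rewrite al0 ltW.
have tauT : - tau <= T by lra.
(* Clamping the argument turns functions that are only controlled on [-tau, T]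
   into functions continuous on all of R. *)
pose Y s := y (clamp (- tau) T s).
have YE s : - tau <= s <= T -> Y s = y s by move=> sT; rewrite /Y clamp_id.
have cY : continuous Y.
  apply: continuous_comp_within cy (continuous_clamp _ _) _ => s.
  by rewrite /= in_itv/= clamp_itv.
have cYd : continuous (fun s => Y (s - tau)).
  move=> s; apply: (@continuous_comp _ _ _ (fun s => s - tau) Y); [|exact: cY].
  by apply: cvgB; [exact: cvg_id | exact: cvg_cst].
(* The time argument has its own clamp, since [f] is continuous only for times in [0, T]. *)
pose F s := f (clamp 0 T s) (Y s) (Y (s - tau)).
have cF : continuous F.
  apply: (continuous_comp_within _ _ _ _ (fun s => (clamp 0 T s, (Y s, Y (s - tau)))) _ cf).
    move=> s; exact: (cvg_pair (continuous_clamp 0 T s) (cvg_pair (cY s) (cYd s))).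
  by move=> s /=; rewrite clamp_itv// ltW.
have coordc (g : R -> 'cV[R]_n) i : continuous g -> continuous (fun s => g s i ord0).
  move=> cg s; apply: (@continuous_comp _ _ _ g (fun x => x i ord0)); first exact: cg.
  exact: coord_continuous.
pose h s := expR ((mu - 1) / mu * s) *: (A *m Y s + B *m Y (s - tau) + F s).
have ch i : continuous (fun s => h s i ord0).
  rewrite (_ : (fun s => _) = (fun s => expR ((mu - 1) / mu * s) *
    (\sum_j A i j * Y s j ord0 + \sum_j B i j * Y (s - tau) j ord0 + F s i ord0))); last first.
    by apply/funext => s; rewrite !mxE.
  move=> s; apply: cvgM; first exact: continuous_expRM.
  apply: cvgD; last exact: coordc.
  apply: cvgD.
    apply: continuous_sumr => j x; apply: cvgM; first exact: cvg_cst.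
    exact: coordc.
  apply: continuous_sumr => j x; apply: cvgM; first exact: cvg_cst.
  exact: (coordc (fun s => Y (s - tau))).
(* For s in [0, q], both s and s - tau lie where the clamps are the identity, so [h] agrees with the
   integrand of the mild equation. *)
have ysolh q : 0 <= q <= T ->
    y q = expR ((mu - 1) / mu * q) *: phi 0 + GPFI alpha mu h q.
  move=> /[dup] qT /andP[q0 q1]; rewrite (ysol q qT).
  apply: (congr1 (fun z => expR ((mu - 1) / mu * q) *: phi 0 + z)).
  apply/colP => i; rewrite !mxE; congr (_ * _).
  apply: eq_Rintegral => s; rewrite inE/= in_itv/= => /andP[s0 sq].
  rewrite /h /F clamp_id ?s0 ?(le_trans sq)//.
  by rewrite !YE//; apply/andP; split; lra.
have lipf s x x' : 0 <= s <= T -> vnorm (f s x x') <= Lf * (vnorm x + vnorm x').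
  (* Since tau > 0, a test function can take arbitrary values at s and s - tau. *)
  move=> sT; have := hf (fun q => if q == s then x else x') (fun=> 0) s sT.
  rewrite eqxx f00// !subr0 ifF//.
  by apply/negP => /eqP; lra.
have hle s : 0 <= s <= T -> vnorm (h s) <=
    (mnorm A + Lf) * vnorm (Y s) + (mnorm B + Lf) * vnorm (Y (s - tau)).
  move=> /[dup] sT /andP[s0 _]; rewrite /h vnormZ ger0_norm ?expR_ge0//.
  have e1 : expR ((mu - 1) / mu * s) <= 1.
    by rewrite expR_le1 mulr_le0_ge0// mulr_le0_ge0 ?invr_ge0 ?subr_le0// ltW.
  rewrite (le_trans (ler_piMl (vnorm_ge0 _) e1))//.
  rewrite (le_trans (vnormD _ _))//.
  have := vnormD (A *m Y s) (B *m Y (s - tau)).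
  have := vnorm_mulmx_le A (Y s); have := vnorm_mulmx_le B (Y (s - tau)).
  have := lipf s (Y s) (Y (s - tau)) sT.
  rewrite /F clamp_id//; lra.
pose K := (mu `^ alpha * Gamma alpha)^-1.
have G0 : 0 < Gamma alpha by exact: Gamma_gt0.
have K0 : 0 < K by rewrite invr_gt0 mulr_gt0 ?powR_gt0.
have cN : continuous (fun s => vnorm (Y s)).
  by apply: continuous_vnorm => i; exact: coordc.
have cNd : continuous (fun s => vnorm (Y (s - tau))).
  by apply: continuous_vnorm => i; exact: coordc.
have phi_le s : - tau <= s <= 0 -> vnorm (phi s) <= c1.
  by move=> st; rewrite (le_trans _ phic1)// vnorm_le_Cnorm.
have Nc s : - tau <= s <= 0 -> vnorm (Y s) <= c1.
  move=> /[dup] st /andP[s1 s2]; rewrite YE ?s1 ?(le_trans s2 (ltW T0))//.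
  by rewrite yphi// phi_le.
have hN q : 0 <= q <= T -> vnorm (Y q) <= c1 + K * \int[lebesgue_measure]_(s in `[0, q])
   ((q - s) `^ (alpha - 1) * ((mnorm A + Lf) * vnorm (Y s) +
     (mnorm B + Lf) * vnorm (Y (s - tau)))).
  move=> /[dup] qT /andP[q0 q1]; rewrite YE; last by rewrite q1 andbT; lra.
  rewrite ysolh// (le_trans (vnormD _ _))// lerD//.
    rewrite vnormZ ger0_norm ?expR_ge0//.
    rewrite (le_trans (ler_piMl (vnorm_ge0 _) _))//.
      by rewrite expR_le1 mulr_le0_ge0// mulr_le0_ge0 ?invr_ge0 ?subr_le0// ltW.
    by apply: phi_le; rewrite lexx oppr_le0 ltW.
  rewrite (le_trans (vnorm_GPFI_le _ _ _ q h a01' mu01 ch))// ler_pM2l//.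
  apply: le_Rintegral => //.
  - by apply: kernel_integrable => //; exact: continuous_vnorm.
  - apply: kernel_integrable => // s.
    apply: cvgD; apply: cvgM; first exact: cvg_cst.
    + exact: cN.
    + exact: cvg_cst.
    + exact: cNd.
  - move=> s; rewrite /= in_itv/= => /andP[s0 sq].
    by rewrite ler_wpM2l ?powR_ge0// hle// s0 (le_trans sq).
(* Positivity of [Lf] covers the case A = 0 and yields psi > 0, as the Gronwall step requires. *)
have a0 : 0 < mnorm A + Lf by rewrite ltr_wpDl ?mnorm_ge0.
have b0 : 0 < mnorm B + Lf by rewrite ltr_wpDl ?mnorm_ge0.
have := fractional_delay_bound _ alpha r k T tau c1 _ _ K a01 erefl erefl (ltW tau0)
  c10 a0 (ltW b0) K0 cN (fun s => vnorm_ge0 (Y s)) Nc hN t ht.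
have r0 : 0 < r by rewrite addr_gt0 ?invr_gt0.
(* The exponent of mu is alpha r = alpha + 1 = k. *)
have Kr : K `^ r = (mu `^ k * Gamma alpha `^ r)^-1.
  rewrite /K -powR_inv1 ?mulr_ge0 ?powR_ge0 ?(ltW G0)//.
  rewrite -powRrM mulN1r powRN powRM ?powR_ge0 ?(ltW G0)// -powRrM.
  congr (_ `^ _ * _)^-1; rewrite /r /k; field; by rewrite gt_eqF.
rewrite Kr.
have -> : 3 `^ alpha^-1 * (mnorm B + Lf) `^ r * (1 - expR (- (r * tau))) / r *
  (Gamma (alpha ^+ 2) / k `^ (alpha ^+ 2)) `^ k^-1 `^ r /
  (mu `^ k * Gamma alpha `^ r) = varphi.
  by rewrite /varphi /omega; field; rewrite !gt_eqF ?powR_gt0.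
rewrite -/omega -/psi => Nt.
have tT : - tau <= t <= T by move: ht => /andP[h1 h2]; rewrite h2 andbT; lra.
rewrite YE// in Nt; apply: (lt_le_trans Nt).
by rewrite mulrC -ler_pdivlMr// hM.
Qed.
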